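(* Let $E=0$, let $m=p$ and let $C$ be invertible. Assume $\gamma_{\min}^A<1<\gamma_{\max}^A<2$, $1\in I_R$ and $1\in I_K$. Then the eigenvalues of $\mathcal{P}^{-1}\mathcal{A}$ not lying in $I_A$ are contained in $I_-^\pi\cup I_+^\pi$, where $$I_-^\pi=\left[\mu_a(\gamma_{\min}^A,\gamma_{\max}^R,\gamma_{\max}^K),\ \mu_a(\gamma_{\max}^A,\gamma_{\min}^R,\gamma_{\min}^K)\right],$$ $$I_+^\pi=\left[\mu_b(\gamma_{\min}^A,\gamma_{\max}^R,\gamma_{\min}^K),\ \max\{\mu_c(\gamma_{\max}^A,\gamma_{\min}^R,\gamma_{\max}^K),\ \mu_c(\gamma_{\max}^A,\gamma_{\max}^R,\gamma_{\max}^K),\ \beta_c(\gamma_{\max}^A,\gamma_{\max}^K)\}\right],$$ and $\beta_c(\gamma_A,\gamma_K)=\min\left\{\frac{1}{2-\gamma_A},\ \gamma_K+\sqrt{\gamma_K^2+\gamma_K}\right\}$.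
   Context: Let $n\ge m\ge p$ be positive integers, $A\in\mathbb{R}^{n\times n}$ symmetric positive definite (SPD), $B\in\mathbb{R}^{m\times n}$ and $C\in\mathbb{R}^{p\times m}$ of full row rank. With $E=0$, $$\mathcal{A}=\begin{bmatrix}A&B^\top&0\\ B&0&C^\top\\ 0&C&0\end{bmatrix}.$$ Let $\widehat A$ be an SPD approximation of $A$; $\widetilde S=B\widehat A^{-1}B^\top$ and $\widehat S$ an SPD approximation of $\widetilde S$; $\widetilde X=C\widehat S^{-1}C^\top$ and $\widehat X$ an SPD approximation of $\widetilde X$ (each hatted matrix is an SPD matrix of the appropriate size). The preconditioner is $\mathcal{P}=\mathcal{P}_L\mathcal{P}_D^{-1}\mathcal{P}_L^\top$ with $$\mathcal{P}_L=\begin{bmatrix}\widehat A&0&0\\ B&-\widehat S&0\\ 0&C&\widehat X\end{bmatrix},\qquad \mathcal{P}_D=\begin{bmatrix}\widehat A&0&0\\ 0&\widehat S&0\\ 0&0&\widehat X\end{bmatrix}.$$ Put $K=\widehat X^{-1/2}C\widehat S^{-1/2}$ and define the intervals $I_A=[\gamma_{\min}^A,\gamma_{\max}^A]$, $I_R=[\gamma_{\min}^R,\gamma_{\max}^R]$, $I_K=[\gamma_{\min}^K,\gamma_{\max}^K]$, whose endpoints are the smallest and largest eigenvalues of $\widehat A^{-1}A$, of $\widehat S^{-1}\widetilde S$, and of $KK^\top$, respectively. Define $p(\lambda;\gamma_A,\gamma_R)=\lambda^2-\lambda(\gamma_A\gamma_R+\gamma_A-2\gamma_R)-\gamma_R$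 and $$\pi(\lambda;\gamma_A,\gamma_R,\gamma_K)=(1+\lambda)^2(\gamma_A-\lambda)\gamma_K+p(\lambda;\gamma_A,\gamma_R)\,\lambda\,(1+\gamma_K).$$ For $\gamma_A\in I_A\setminus\{1\}$, $\gamma_R\in I_R$, $\gamma_K\in I_K$, this cubic in $\lambda$ has three distinct real roots, denoted $\mu_a(\gamma_A,\gamma_R,\gamma_K)<0<\mu_b(\gamma_A,\gamma_R,\gamma_K)<\mu_c(\gamma_A,\gamma_R,\gamma_K)$. *)

(* Defs.v *)
From mathcomp Require Import all_boot all_order all_algebra.
From mathcomp Require Import reals.
From mathcomp Require Import polyrcf complex.

Set Implicit Arguments.
Unset Strict Implicit.
Unset Printing Implicit Defensive.

Import Order.TTheory GRing.Theory Num.Theory.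
Local Open Scope ring_scope.

Section Matrices.
Variable R : realType.

Definition spd (n : nat) (A : 'M[R]_n) : Prop :=
  A^T = A /\ forall v : 'cV[R]_n, v != 0 -> 0 < (v^T *m A *m v) 0 0.

(* H = A^{1/2}: the (unique) SPD square root of the SPD matrix A *)
Definition spd_sqrt (n : nat) (A H : 'M[R]_n) : Prop :=
  spd H /\ H *m H = A.

(* Extremal real eigenvalues; only used for matrices with real spectrum. *)
Definition smallest_eigenvalue (n : nat) (A : 'M[R]_n) (a : R) : Prop :=
  eigenvalue A a /\ forall b : R, eigenvalue A b -> a <= b.

Definition largest_eigenvalue (n : nat) (A : 'M[R]_n) (a : R) : Prop :=
  eigenvalue A a /\ forall b : R, eigenvalue A b -> b <= a.

Definition complex_eigenvalue (n : nat) (A : 'M[R]_n) (z : R[i]) : bool :=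
  eigenvalue (map_mx (real_complex R) A) z.

Section Blocks.
Variables (n m p : nat).

(* The double saddle-point matrix with E = 0. *)
Definition saddle_mx (A : 'M[R]_n) (B : 'M[R]_(m, n)) (C : 'M[R]_(p, m)) :
    'M[R]_(n + m + p) :=
  block_mx (block_mx A B^T B 0) (col_mx 0 C^T) (row_mx 0 C) 0.

Definition precL (Ah : 'M[R]_n) (Sh : 'M[R]_m) (Xh : 'M[R]_p)
    (B : 'M[R]_(m, n)) (C : 'M[R]_(p, m)) : 'M[R]_(n + m + p) :=
  block_mx (block_mx Ah 0 B (- Sh)) 0 (row_mx 0 C) Xh.

Definition precD (Ah : 'M[R]_n) (Sh : 'M[R]_m) (Xh : 'M[R]_p) :
    'M[R]_(n + m + p) :=
  block_mx (block_mx Ah 0 0 Sh) 0 0 Xh.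

Definition prec (Ah : 'M[R]_n) (Sh : 'M[R]_m) (Xh : 'M[R]_p)
    (B : 'M[R]_(m, n)) (C : 'M[R]_(p, m)) : 'M[R]_(n + m + p) :=
  precL Ah Sh Xh B C *m invmx (precD Ah Sh Xh) *m (precL Ah Sh Xh B C)^T.

Definition schurS (Ah : 'M[R]_n) (B : 'M[R]_(m, n)) : 'M[R]_m :=
  B *m invmx Ah *m B^T.

End Blocks.
End Matrices.

Section Cubic.
Variable R : realType.

(* p(lambda; gA, gR) and pi(lambda; gA, gR, gK) as polynomials in lambda *)
Definition quad_poly (gA gR : R) : {poly R} :=
  'X^2 - (gA * gR + gA - 2 * gR) *: 'X - gR%:P.

Definition cubic_poly (gA gR gK : R) : {poly R} :=
  gK *: ((1 + 'X) ^+ 2 * (gA%:P - 'X))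
  + (1 + gK) *: (quad_poly gA gR * 'X).

(* rootsR lists the distinct real roots in increasing order; for the
   parameters considered there are exactly three of them, and
   mu_a < 0 < mu_b < mu_c. *)
Definition mu_a (gA gR gK : R) : R := (rootsR (cubic_poly gA gR gK))`_0.
Definition mu_b (gA gR gK : R) : R := (rootsR (cubic_poly gA gR gK))`_1.
Definition mu_c (gA gR gK : R) : R := (rootsR (cubic_poly gA gR gK))`_2.

Definition beta_c (gA gK : R) : R :=
  Num.min (1 / (2 - gA)) (gK + Num.sqrt (gK ^+ 2 + gK)).

End Cubic.

(* Main.v *)
Require Import Defs.
From mathcomp Require Import all_boot all_order all_algebra.
From mathcomp Require Import ring lra.
From mathcomp Require Import reals.
From mathcomp Require Import polyrcf complex.

Set Implicit Arguments.
Unset Strict Implicit.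
Unset Printing Implicit Defensive.

Import Order.TTheory GRing.Theory Num.Theory.
Local Open Scope ring_scope.

(**
  Since [prec] is symmetric positive definite and [saddle_mx] is symmetric, an
  eigenvalue l of the preconditioned matrix is real and has a real eigenvector
  (x, y, z).  When l lies outside I_A, it is nonzero and y does not vanish.
  Pairing the second block equation with y after eliminating x and z leaves

    (1 + l)^2 / l * k / (1 + k) - l (r + 1) - (1 - l)^2 r / (a - l) = 0,

  where a, r, k are values in I_A, I_R, I_K produced by Rayleigh quotients of
  definite pencils; equivalently l is a root of the cubic pi(.; a, r, k).  The
  left-hand side is monotone in a and k and affine in r with slope
  (l (2 - a) - 1) / (a - l), so moving (a, r, k) to the appropriate corner of
  I_A x I_R x I_K fixes the sign of the cubic at l, and hence the position of
  l with respect to the roots of the corner cubic.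
*)

(** * The cubic and its roots *)

Section Cubic.
Variable R : realType.
Implicit Types a r k x : R.

Lemma horner_cubic a r k x :
  (cubic_poly a r k).[x] = (1 + x) ^+ 2 * (a - x) * k
    + (x ^+ 2 - x * (a * r + a - 2 * r) - r) * x * (1 + k).
Proof. rewrite /cubic_poly /quad_poly !hornerE /=; ring. Qed.

(** The coefficients [- k] and [1 + k] of the third power add up to [1], so size and monicity can be
    read off this form. *)
Lemma cubic_polyE a r k : cubic_poly a r k = 'X^3
  + \poly_(i < 3) [:: k * a; k * (2 * a - 1) - (1 + k) * r;
                      k * (a - 2) - (1 + k) * (a * r + a - 2 * r)]`_i.
Proof.
rewrite poly_def !big_ord_recl big_ord0 /= /cubic_poly /quad_poly.
rewrite -!mul_polyC !(rmorphD, rmorphM, rmorphB, rmorph1, rmorphN, rmorph_nat) /=.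
by rewrite /bump /= expr0 addn0 addr0 expr1; ring.
Qed.

Lemma size_cubic a r k : size (cubic_poly a r k) = 4.
Proof. by rewrite cubic_polyE size_polyDl size_polyXn // ltnS size_poly. Qed.

Lemma cubic_monic a r k : cubic_poly a r k \is monic.
Proof.
rewrite monicE cubic_polyE lead_coefDl ?lead_coefXn // size_polyXn.
by rewrite ltnS size_poly.
Qed.

(** The value at [0] is [a * k > 0] and the value at [a] is
    [- (r * (a - 1) ^+ 2 * a * (1 + k)) < 0], so the monic cubic changes sign once below [0], once
    between [0] and [a], and once above [a]. *)
Lemma cubic_roots a r k : 0 < a -> a != 1 -> 0 < r -> 0 < k ->
  [/\ mu_a a r k < 0, 0 < mu_b a r k < a, a < mu_c a r k &
   forall x, (cubic_poly a r k).[x]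
     = (x - mu_a a r k) * (x - mu_b a r k) * (x - mu_c a r k)].
Proof.
move=> a0 a1 r0 k0; set q := cubic_poly a r k.
have q0 : 0 < q.[0] by rewrite horner_cubic; nra.
have qa : q.[a] < 0.
  rewrite horner_cubic.
  have -> : (1 + a) ^+ 2 * (a - a) * k +
     (a ^+ 2 - a * (a * r + a - 2 * r) - r) * a * (1 + k) =
     - (r * (a - 1) ^+ 2 * a * (1 + k)) by ring.
  rewrite oppr_lt0; apply: mulr_gt0; last lra.
  by rewrite mulr_gt0 // mulr_gt0 // exprn_even_gt0 //= subr_eq0.
have q_neq0 : q != 0 by rewrite -size_poly_eq0 size_cubic.
have lq : lead_coef q = 1 by apply/monicP/cubic_monic.
(* From the Cauchy bound on, the sign is that of the leading term; the second entry forces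
   [a < M]. *)
set M := Num.max (cauchy_bound q) (a + 1).
have aM : a < M by rewrite lt_max ltrDl ltr01 orbT.
have qM : 0 < q.[M].
  rewrite -sgr_cp0 (sgp_pinftyP (ge_cauchy_bound q_neq0)).
    by rewrite /sgp_pinfty lq sgr1.
  by rewrite in_itv /= andbT le_max lexx.
have qNM : q.[- M] < 0.
  rewrite -sgr_cp0 (sgp_minftyP (le_cauchy_bound q_neq0)).
    by rewrite /sgp_minfty lq mulr1 size_cubic /= -signr_odd /= expr1 sgrN sgr1.
  by rewrite in_itv /= lerN2 le_max lexx.
have [||x xI qx] := @poly_ivtoo _ q (- M) 0; [lra | nra |].
have [||y yI qy] := @poly_ivtoo _ q 0 a; [lra | nra |].
have [||z zI qz] := @poly_ivtoo _ q a M; [lra | nra |].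
move: xI yI zI; rewrite !in_itv /= => /andP[_ x0] /andP[y0 ya] /andP[az _].
have xyz_uniq : poly.uniq_roots [:: x; y; z].
  rewrite uniq_rootsE /= !inE !negb_or; apply/and3P.
  by split=> //; [apply/andP; split|]; rewrite lt_eqF //; lra.
have qE : q = \prod_(t <- [:: x; y; z]) ('X - t%:P).
  rewrite [LHS](@all_roots_prod_XsubC _ q [:: x; y; z]) ?lq ?scale1r //.
    by rewrite size_cubic.
  by rewrite /= qx qy qz.
(* [rootsR] is sorted and has the same members, so the indices 0, 1, 2 select [x], [y], [z] and
   never the default value. *)
have rE : rootsR q = [:: x; y; z].
  apply: lt_sorted_eq; first exact: sorted_roots.
    by rewrite /= (lt_trans x0 y0) (lt_trans ya az).
  move=> t; rewrite -roots_on_rootsR // in_itv /= qE.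
  by rewrite root_prod_XsubC.
rewrite /mu_a /mu_b /mu_c -/q rE /=; split; rewrite ?y0 //.
by move=> t; rewrite qE !big_cons big_nil mulr1 !hornerM !hornerXsubC mulrA.
Qed.

(* [cubic_poly] divided by [x * (1 + k) * (a - x)]: in this form it is monotone
   in [a] and in [k] and affine in [r]. *)
Definition cubic_quot (x a r k : R) : R :=
  (1 + x) ^+ 2 / x * (k / (1 + k)) - x * (r + 1) - (1 - x) ^+ 2 * r / (a - x).

Lemma cubic_quotE x a r k : x != 0 -> a != x -> 0 < k ->
  (cubic_poly a r k).[x] = cubic_quot x a r k * (x * (1 + k) * (a - x)).
Proof.
move=> x0 ax k0; have k1 : 1 + k != 0 by rewrite gt_eqF //; lra.
have {}ax : a - x != 0 by rewrite subr_eq0.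
by rewrite horner_cubic /cubic_quot; field; rewrite x0 k1 ax.
Qed.

Lemma cubic_quot_mono_k x a r k k' : 0 < k -> k <= k' ->
  (0 < x -> cubic_quot x a r k <= cubic_quot x a r k') /\
  (x < 0 -> cubic_quot x a r k' <= cubic_quot x a r k).
Proof.
move=> k0 kk'.
have h : k / (1 + k) <= k' / (1 + k').
  have k1 : 0 < 1 + k by lra.
  have k1' : 0 < 1 + k' by lra.
  by rewrite ler_pdivrMr // mulrAC ler_pdivlMr //; lra.
split=> x0; rewrite /cubic_quot !lerD2r.
  by rewrite ler_wpM2l // mulr_ge0 ?sqr_ge0 // invr_ge0 ltW.
by rewrite ler_wnM2l // mulr_ge0_le0 ?sqr_ge0 // invr_le0 ltW.
Qed.

(** The sign condition keeps [a] and [a'] on the same side of the pole at [x], where [- 1 / (a - x)]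
    increases with [a]. *)
Lemma cubic_quot_mono_a x a a' r k : 0 < (a - x) * (a' - x) -> 0 <= r ->
  a <= a' -> cubic_quot x a r k <= cubic_quot x a' r k.
Proof.
move=> ax r0 aa'; rewrite /cubic_quot lerD2l lerN2.
apply: ler_wpM2l; first by rewrite mulr_ge0 ?sqr_ge0.
have /andP[u0 v0] : (a - x != 0) && (a' - x != 0).
  by rewrite -negb_or -mulf_eq0 gt_eqF.
have e : (a - x)^-1 - (a' - x)^-1 = (a' - a) / ((a - x) * (a' - x)).
  by field; rewrite u0 v0.
by rewrite -subr_ge0 e divr_ge0 ?subr_ge0 // ltW.
Qed.

(** In [- x * (a - x) - (1 - x) ^+ 2] the squares of [x] cancel, so the numerator of the slope is
    linear in [x]. *)
Lemma cubic_quotBr x a r r' k : a != x ->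
  cubic_quot x a r' k - cubic_quot x a r k =
  (r' - r) * ((x * (2 - a) - 1) / (a - x)).
Proof.
rewrite -subr_eq0 => ax; rewrite /cubic_quot.
by move: (_ / x * _) => t; field.
Qed.

(** For negative [x] the scaling factor is negative and the two factors of the larger roots have a
    positive product, so [x - mu_a a r k] and the quotient have opposite signs. *)
Lemma mu_a_bounds x a r k : 0 < a -> a != 1 -> 0 < r -> 0 < k -> x < 0 ->
  (cubic_quot x a r k <= 0 -> mu_a a r k <= x) /\
  (0 <= cubic_quot x a r k -> x <= mu_a a r k).
Proof.
move=> a0 a1 r0 k0 x0; have [mua /andP[mub _] muc qE] := cubic_roots a0 a1 r0 k0.
have ax : a != x by rewrite gt_eqF // (lt_trans x0).
have xn0 : x != 0 by rewrite lt_eqF.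
have := qE x; rewrite (cubic_quotE r xn0 ax k0); set q := cubic_quot _ _ _ _.
have : x * (1 + k) * (a - x) < 0.
  have xk : x * (1 + k) < 0 by rewrite nmulr_rlt0 // addr_gt0.
  by rewrite nmulr_rlt0 // subr_gt0 (lt_trans x0).
move: (_ * (1 + k) * _) => d d0 e.
have : 0 < (x - mu_b a r k) * (x - mu_c a r k).
  by rewrite nmulr_rgt0 subr_lt0; lra.
rewrite -mulrA in e; move: (_ * (x - mu_c _ _ _)) e => f e f0.
by split=> q0; [rewrite -subr_ge0 -(pmulr_lge0 _ f0) -e nmulr_lge0|
  rewrite -subr_le0 -(pmulr_lle0 _ f0) -e nmulr_lle0].
Qed.

(** Here the scaling factor is positive and [x] lies strictly between the outer roots, so only the
    factor of [mu_b] has an unknown sign. *)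
Lemma mu_b_le x a r k : 0 < a -> a != 1 -> 0 < r -> 0 < k -> 0 < x -> x < a ->
  cubic_quot x a r k <= 0 -> mu_b a r k <= x.
Proof.
move=> a0 a1 r0 k0 x0 xa q0; have [mua _ muc qE] := cubic_roots a0 a1 r0 k0.
have xn0 : x != 0 by rewrite gt_eqF.
have ax : a != x by rewrite gt_eqF.
have := qE x; rewrite (cubic_quotE r xn0 ax k0) => e.
have : 0 <= (x - mu_b a r k) * ((x - mu_a a r k) * (mu_c a r k - x)).
  have -> : (x - mu_b a r k) * ((x - mu_a a r k) * (mu_c a r k - x)) =
    - cubic_quot x a r k * (x * (1 + k) * (a - x)) by rewrite mulNr e; ring.
  by rewrite mulr_ge0 ?oppr_ge0 // !mulr_ge0 ?subr_ge0 ?addr_ge0 ?ltW.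
rewrite pmulr_lge0 ?subr_ge0 // mulr_gt0 ?subr_gt0 ?(lt_trans mua) //.
exact: lt_trans muc.
Qed.

Lemma le_mu_c x a r k : 0 < a -> a != 1 -> 0 < r -> 0 < k -> a < x ->
  0 <= cubic_quot x a r k -> x <= mu_c a r k.
Proof.
move=> a0 a1 r0 k0 ax q0; have [mua /andP[_ mub] muc qE] := cubic_roots a0 a1 r0 k0.
have x0 : 0 < x by exact: lt_trans ax.
have xn0 : x != 0 by rewrite gt_eqF.
have xna : a != x by rewrite lt_eqF.
have := qE x; rewrite (cubic_quotE r xn0 xna k0) => e.
have : 0 <= (mu_c a r k - x) * ((x - mu_a a r k) * (x - mu_b a r k)).
  have -> : (mu_c a r k - x) * ((x - mu_a a r k) * (x - mu_b a r k)) =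
    cubic_quot x a r k * (x * (1 + k) * (x - a)).
    by rewrite -[x - a]opprB !mulrN e; ring.
  by rewrite mulr_ge0 // !mulr_ge0 ?subr_ge0 ?addr_ge0 ?ltW.
rewrite pmulr_lge0 ?subr_ge0 // mulr_gt0 ?subr_gt0 ?(lt_trans mua) //.
exact: lt_trans ax.
Qed.

(** Starting from the value [0] at [(a, r, k)], the parameters move to a corner one at a time, all
    inequalities pointing the same way. As [x] is outside the whole interval, moving [a] never
    crosses the pole. *)
Lemma cubic_root_bounds amin amax rmin rmax kmin kmax a r k x :
    0 < amin -> amin < 1 -> 1 < amax -> amax < 2 -> 0 < rmin -> 0 < kmin ->
    a \in `[amin, amax] -> r \in `[rmin, rmax] -> k \in `[kmin, kmax] ->
    x != 0 -> x \notin `[amin, amax] -> root (cubic_poly a r k) x ->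
  x \in `[mu_a amin rmax kmax, mu_a amax rmin kmin] \/
  x \in `[mu_b amin rmax kmin,
          Num.max (mu_c amax rmin kmax) (mu_c amax rmax kmax)].
Proof.
move=> amin0 amin1 amax1 amax2 rmin0 kmin0; rewrite !in_itv /= negb_and -!ltNge.
move=> /andP[a_ge a_le] /andP[r_ge r_le] /andP[k_ge k_le] x0 xnI /rootP.
have rmax0 : 0 < rmax by lra.
have kmax0 : 0 < kmax by lra.
have amin_neq1 : amin != 1 by rewrite lt_eqF.
have amax_neq1 : amax != 1 by rewrite gt_eqF.
have r0 : 0 < r by lra.
have k0 : 0 < k by lra.
have ax : a != x by case/orP: xnI => xI; [rewrite gt_eqF | rewrite lt_eqF]; lra.
have k1 : 1 + k != 0 by rewrite gt_eqF; lra.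
have ax0 : a - x != 0 by rewrite subr_eq0.
rewrite cubic_quotE // => /eqP; rewrite !mulf_eq0 (negPf x0) (negPf k1).
rewrite (negPf ax0) !orbF => /eqP q0.
have amax0 : 0 < amax by lra.
have [xneg|xpos|/eqP] := ltgtP x 0; last by rewrite (negPf x0).
  left; apply/andP; split.
    apply: (mu_a_bounds amin0 amin_neq1 rmax0 kmax0 xneg).1.
    have [_ /(_ xneg) h1] := cubic_quot_mono_k x amin rmax k0 k_le.
    (* For [x < 0] and [amin < 2] the numerator [x * (2 - amin) - 1] is negative and [amin - x]
       positive, so the quotient decreases in [r]. *)
    have h2 : cubic_quot x amin rmax k <= cubic_quot x amin r k.
      rewrite -subr_le0 cubic_quotBr; last by rewrite gt_eqF; lra.
      by rewrite mulr_ge0_le0 ?subr_ge0 // mulr_le0_ge0 ?invr_ge0; nra.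
    have := @cubic_quot_mono_a x amin a r k.
    rewrite q0 => h3; apply: le_trans h1 (le_trans h2 (h3 _ _ _)); try lra.
    by apply: mulr_gt0; lra.
  apply: (mu_a_bounds amax0 amax_neq1 rmin0 kmin0 xneg).2.
  have [_ /(_ xneg) h1] := cubic_quot_mono_k x amax rmin kmin0 k_ge.
  have h2 : cubic_quot x amax r k <= cubic_quot x amax rmin k.
    rewrite -subr_le0 cubic_quotBr; last by rewrite gt_eqF; lra.
    by rewrite mulr_ge0_le0 ?subr_ge0 // mulr_le0_ge0 ?invr_ge0; nra.
  have := @cubic_quot_mono_a x a amax r k.
  rewrite q0 => h3; apply: le_trans (le_trans (h3 _ _ _) h2) h1; try lra.
  by apply: mulr_gt0; lra.
(* Left of [amin] the upper bound is automatic, as [mu_c] exceeds [amax]; right of [amax] the lower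
   bound is automatic, as [mu_b] is below [amin]. *)
right; case/orP: xnI => xI; apply/andP; split.
- apply: (mu_b_le amin0 amin_neq1 rmax0 kmin0 xpos xI).
  have [/(_ xpos) h1 _] := cubic_quot_mono_k x amin rmax kmin0 k_ge.
  (* Now [x * (2 - amin) < amin * (2 - amin) <= 1], so the slope in [r] is again negative. *)
  have h2 : cubic_quot x amin rmax k <= cubic_quot x amin r k.
    rewrite -subr_le0 cubic_quotBr; last by rewrite gt_eqF; lra.
    by rewrite mulr_ge0_le0 ?subr_ge0 // mulr_le0_ge0 ?invr_ge0; nra.
  have := @cubic_quot_mono_a x amin a r k.
  rewrite q0 => h3; apply: le_trans h1 (le_trans h2 (h3 _ _ _)); try lra.
  by apply: mulr_gt0; lra.
- have [_ _ muc _] := cubic_roots amax0 amax_neq1 rmin0 kmax0.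
  by rewrite le_max; apply/orP; left; lra.
- have [_ /andP[_ mub] _ _] := cubic_roots amin0 amin_neq1 rmax0 kmin0; lra.
have [/(_ xpos) h1 _] := cubic_quot_mono_k x amax r k0 k_le.
have h3 : 0 <= cubic_quot x amax r k.
  by rewrite -q0; apply: cubic_quot_mono_a; rewrite ?nmulr_rgt0; lra.
rewrite le_max; apply/orP.
have xamax : amax != x by rewrite lt_eqF.
(* Right of [amax] the sign of the slope in [r] is not determined, so both
   endpoints of the range of [r] are needed. *)
have [d0|d0] := lerP 0 ((x * (2 - amax) - 1) / (amax - x)).
  right; apply: le_mu_c => //; apply: le_trans h3 (le_trans h1 _).
  by rewrite -subr_ge0 cubic_quotBr // mulr_ge0 ?subr_ge0.
left; apply: le_mu_c => //; apply: le_trans h3 (le_trans h1 _).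
by rewrite -subr_ge0 cubic_quotBr // mulr_le0 ?subr_le0 // ltW.
Qed.

End Cubic.

(** * Symmetric positive definite matrices *)

Section Spd.
Variable R : realType.

Definition dotc n (u v : 'cV[R]_n) : R := (u^T *m v) 0 0.

Lemma dotcE n (u v : 'cV[R]_n) : dotc u v = \sum_i u i 0 * v i 0.
Proof. by rewrite /dotc mxE; apply: eq_bigr => i _; rewrite mxE. Qed.

Lemma dotcC n (u v : 'cV[R]_n) : dotc u v = dotc v u.
Proof. by rewrite !dotcE; apply: eq_bigr => i _; rewrite mulrC. Qed.

Lemma dotcDr n (u v w : 'cV[R]_n) : dotc u (v + w) = dotc u v + dotc u w.
Proof. by rewrite /dotc mulmxDr mxE. Qed.

Lemma dotcZr n a (u v : 'cV[R]_n) : dotc u (a *: v) = a * dotc u v.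
Proof. by rewrite /dotc -scalemxAr mxE. Qed.

Lemma dotcZl n a (u v : 'cV[R]_n) : dotc (a *: u) v = a * dotc u v.
Proof. by rewrite dotcC dotcZr dotcC. Qed.

Lemma dotcNr n (u v : 'cV[R]_n) : dotc u (- v) = - dotc u v.
Proof. by rewrite -scaleN1r dotcZr mulN1r. Qed.

Lemma dotc_mull m n (M : 'M[R]_(m, n)) u v : dotc (M *m u) v = dotc u (M^T *m v).
Proof. by rewrite /dotc trmx_mul mulmxA. Qed.

Lemma dotc_gt0 n (u : 'cV[R]_n) : u != 0 -> 0 < dotc u u.
Proof.
move=> u0; have h i : 0 <= u i 0 * u i 0 by rewrite -expr2 sqr_ge0.
rewrite lt_def dotcE sumr_ge0 ?andbT //; apply: contra u0.
rewrite psumr_eq0 // => /allP u0; apply/eqP/matrixP => i j.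
by have := u0 i (mem_index_enum i); rewrite (ord1 j) mxE mulf_eq0 orbb => /eqP.
Qed.

Lemma spdP n (H : 'M[R]_n) :
  spd H <-> H^T = H /\ forall u, u != 0 -> 0 < dotc u (H *m u).
Proof. by split=> -[hT h]; split=> // u /h; rewrite /dotc mulmxA. Qed.

Lemma spd_scalar1 n : spd (1%:M : 'M[R]_n).
Proof. by apply/spdP; split=> [|u /dotc_gt0]; rewrite ?trmx1 ?mul1mx. Qed.

Lemma spd_inj n (H : 'M[R]_n) (u : 'cV_n) : spd H -> H *m u = 0 -> u = 0.
Proof.
move=> /spdP[_ hp] Hu; apply/eqP/negPn/negP => /hp.
by rewrite Hu /dotc mulmx0 mxE ltxx.
Qed.

Lemma spd_unit n (H : 'M[R]_n) : spd H -> H \in unitmx.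
Proof.
move=> hH; rewrite -row_free_unit; apply: inj_row_free => v vH.
apply: trmx_inj; rewrite trmx0; apply: (spd_inj hH).
by case: hH => hT _; rewrite -[in LHS]hT -trmx_mul vH trmx0.
Qed.

Lemma spd_congr m n (H : 'M[R]_n) (M : 'M[R]_(n, m)) :
  spd H -> (forall u : 'cV_m, M *m u = 0 -> u = 0) -> spd (M^T *m H *m M).
Proof.
move=> /spdP[hT hp] hM; apply/spdP; split=> [|u u0].
  by rewrite !trmx_mul hT trmxK mulmxA.
rewrite -!mulmxA -dotc_mull; apply: hp.
by apply: contra u0 => /eqP/hM->.
Qed.

Lemma spd_inv n (H : 'M[R]_n) : spd H -> spd (invmx H).
Proof.
move=> hH; have uH := spd_unit hH; have hT := hH.1.
have -> : invmx H = (invmx H)^T *m H *m invmx H.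
  by rewrite trmx_inv hT mulVmx // mul1mx.
apply: spd_congr => // u hu; by rewrite -[u](mulKVmx uH) hu mulmx0.
Qed.

Lemma spd_schur m n (H : 'M[R]_n) (B : 'M[R]_(m, n)) : spd H ->
  (forall u : 'cV_m, B^T *m u = 0 -> u = 0) -> spd (schurS H B).
Proof.
move=> hH hB; rewrite /schurS -[X in X *m _ *m _]trmxK.
by apply: spd_congr => //; exact: spd_inv.
Qed.

Lemma spd_add n (H G : 'M[R]_n) : spd H -> spd G -> spd (H + G).
Proof.
move=> /spdP[hT hp] /spdP[gT gp]; apply/spdP; split=> [|u u0].
  by rewrite linearD /= hT gT.
by rewrite mulmxDl dotcDr addr_gt0 ?hp ?gp.
Qed.

Lemma dotc_col_mx m n (u v : 'cV[R]_m) (w z : 'cV[R]_n) :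
  dotc (col_mx u w) (col_mx v z) = dotc u v + dotc w z.
Proof. by rewrite /dotc tr_col_mx mul_row_col mxE. Qed.

Lemma spd_block m n (H : 'M[R]_m) (G : 'M[R]_n) :
  spd H -> spd G -> spd (block_mx H 0 0 G).
Proof.
move=> /spdP[hT hp] /spdP[gT gp]; apply/spdP; split=> [|u].
  by rewrite tr_block_mx hT gT !trmx0.
rewrite -[u]vsubmxK; set x := usubmx u; set y := dsubmx u.
rewrite mul_block_col !mul0mx addr0 add0r dotc_col_mx.
have [-> | x0 _] := eqVneq x 0.
  have [-> | y0 _] := eqVneq y 0; first by rewrite col_mx0 eqxx.
  by rewrite mulmx0 {1}/dotc mulmx0 mxE add0r gp.
have [-> | y0] := eqVneq y 0; last by rewrite addr_gt0 ?hp ?gp.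
by rewrite [X in _ + X]/dotc !mulmx0 [X in _ + X]mxE addr0 hp.
Qed.

(** [eigenvalue] speaks of row vectors; transposition sends a row [v] to the column
    [invmx H *m v^T]. The field is generic because both [R] and [R[i]] are needed. *)
Lemma eigenvalue_pencilP n (F : fieldType) (H A : 'M[F]_n) (z : F) :
  H^T = H -> A^T = A -> H \in unitmx ->
  reflect (exists2 v : 'cV_n, v != 0 & A *m v = z *: (H *m v))
    (eigenvalue (invmx H *m A) z).
Proof.
move=> hT aT uH; apply: (iffP eigenvalueP) => [[v]|[v]].
  move=> /(congr1 trmx); rewrite !trmx_mul trmx_inv hT aT linearZ /= => e v0.
  exists (invmx H *m v^T); last by rewrite mulmxA e mulKVmx.
  apply: contra v0 => /eqP/(congr1 (mulmx H)); rewrite mulKVmx // mulmx0.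
  by move=> /(congr1 trmx); rewrite trmxK trmx0 => ->.
move=> v0 e; exists (H *m v)^T.
  apply: trmx_inj; rewrite !trmx_mul trmx_inv hT aT trmxK linearZ /= trmx_mul.
  by rewrite hT trmxK -mulmxA mulKmx.
apply: contra v0 => /eqP/(congr1 trmx); rewrite trmxK trmx0 => e0.
by rewrite -[v](mulKmx uH) e0 mulmx0.
Qed.

End Spd.

(** * Symmetric definite pencils *)

Section Pencil.
Variable R : realType.

Local Notation toC := (map_mx (real_complex R)).
Local Notation "M ^h" := (map_mx Num.conj M^T) (at level 2, format "M ^h").

Definition pencil_eigen n (A H : 'M[R]_n) (d : R) : Prop :=
  exists2 u : 'cV_n, u != 0 & A *m u = d *: (H *m u).

Lemma conj_real_complex (x : R) : Num.conj (x%:C)%C = (x%:C)%C.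
Proof. by apply/CrealP; rewrite complex_real. Qed.

Lemma map_complexH m n (M : 'M[R]_(m, n)) : (toC M)^h = toC M^T.
Proof. by apply/matrixP => i j; rewrite !mxE conj_real_complex. Qed.

Lemma mxC_rect m n (u : 'M[R[i]]_(m, n)) :
  exists a b : 'M[R]_(m, n), u = toC a + 'i%C *: toC b.
Proof.
exists (map_mx (@complex.Re R) u), (map_mx (@complex.Im R) u).
by apply/matrixP => i j; rewrite !mxE; exact: complexE.
Qed.

Lemma mxC_rect_inj m n (a b c d : 'M[R]_(m, n)) :
  toC a + 'i%C *: toC b = toC c + 'i%C *: toC d -> a = c /\ b = d.
Proof.
move=> /matrixP e; split; apply/matrixP => i j; have := e i j; rewrite !mxE.
  by move=> /eqP; rewrite eq_complex /= => /andP[/eqP]; lra.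
by move=> /eqP; rewrite eq_complex /= => /andP[_ /eqP]; lra.
Qed.

(** Write [v = a + i b] and [z = l + i m]. Pairing the real part with [b] and the imaginary part
    with [a], symmetry cancels everything except [m] times a positive number; then [a] or [b] is a
    real eigenvector. *)
Lemma pencil_real n (A H : 'M[R]_n) (z : R[i]) (v : 'cV_n) :
    A^T = A -> spd H -> v != 0 -> toC A *m v = z *: (toC H *m v) ->
  exists2 d, z = (d%:C)%C & pencil_eigen A H d.
Proof.
move=> aT /spdP[hT hp]; have [a [b ->]] := mxC_rect v; case: z => l m v0.
have -> : toC A *m (toC a + 'i%C *: toC b) = toC (A *m a) + 'i%C *: toC (A *m b).
  by rewrite mulmxDr -scalemxAr !map_mxM.
have -> : (l +i* m)%C *: (toC H *m (toC a + 'i%C *: toC b)) =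
    toC (l *: (H *m a) - m *: (H *m b)) + 'i%C *: toC (m *: (H *m a) + l *: (H *m b)).
  rewrite mulmxDr -scalemxAr -!map_mxM /=; apply/matrixP => i j; rewrite !mxE.
  by apply/eqP; rewrite eq_complex /=; apply/andP; split; apply/eqP; ring.
move=> /mxC_rect_inj[ea eb].
have ab0 : (a != 0) || (b != 0).
  rewrite -negb_and; apply: contra v0 => /andP[/eqP-> /eqP->].
  by rewrite !map_mx0 scaler0 addr0.
have pos : 0 < dotc a (H *m a) + dotc b (H *m b).
  have h u : 0 <= dotc u (H *m u).
    by have [->|/hp/ltW//] := eqVneq u 0; rewrite mulmx0 /dotc mulmx0 mxE.
  by case/orP: ab0 => /hp u0; [rewrite ltr_wpDr|rewrite ltr_wpDl].
have m0 : m = 0.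
  have := congr1 (dotc b) ea; have := congr1 (dotc a) eb.
  rewrite !dotcDr !dotcNr !dotcZr.
  have -> : dotc b (A *m a) = dotc a (A *m b) by rewrite dotcC dotc_mull aT.
  have -> : dotc b (H *m a) = dotc a (H *m b) by rewrite dotcC dotc_mull hT.
  move=> -> e; have /eqP : m * (dotc a (H *m a) + dotc b (H *m b)) = 0 by lra.
  by rewrite mulf_eq0 (gt_eqF pos) orbF => /eqP.
exists l; first by rewrite m0.
move: ea eb; rewrite m0 !scale0r subr0 add0r => ea eb.
by case/orP: ab0 => u0; [exists a|exists b].
Qed.

Lemma pencil_eigen_gt0 n (A H : 'M[R]_n) d :
  spd A -> spd H -> pencil_eigen A H d -> 0 < d.
Proof.
move=> /spdP[_ ap] /spdP[_ hp] [u u0 /(congr1 (dotc u))].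
by rewrite dotcZr => e; have := ap _ u0; rewrite e pmulr_lgt0 ?hp.
Qed.

(** * Simultaneous diagonalization and quadratic forms *)

Lemma hermitian_diag n (N : 'M[R[i]]_n) : N^h = N ->
  exists V D, [/\ V \in unitmx, invmx V = V^h & N = V^h *m diag_mx D *m V].
Proof.
move=> hN; have /spectral.orthomx_spectralP e : N \is spectral.normalmx.
  by apply/spectral.normalmxP; rewrite hN.
have U := spectral.spectral_unitarymx N.
exists (spectral.spectralmx N), (spectral.spectral_diag N).
by split; rewrite -?spectral.invmx_unitary ?spectral.spectral_unit.
Qed.

(** The spectral entries are eigenvalues of the pencil of [H] with the identity, hence real and
    positive; their square roots times the unitary factor give [W]. *)
Lemma spd_factor n (H : 'M[R]_n) : spd H ->
  exists2 W : 'M[R[i]]_n, W \in unitmx & toC H = W^h *m W.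
Proof.
move=> hH; have /hermitian_diag[V [D [uV iV e]]] : (toC H)^h = toC H.
  by rewrite map_complexH hH.1.
have D_gt0 i : 0 < D 0 i.
  have [||||d -> dH] := @pencil_real _ H 1%:M (D 0 i) (invmx V *m delta_mx i 0).
  - exact: hH.1.
  - exact: spd_scalar1.
  - apply/eqP => /(congr1 (mulmx V)); rewrite mulKVmx // mulmx0 => /matrixP/(_ i 0).
    by rewrite !mxE !eqxx => /eqP; rewrite oner_eq0.
  - rewrite e -!mulmxA mulKVmx // map_mx1 mul1mx -iV scalemxAr.
    congr (_ *m _); apply/matrixP => j k; rewrite mul_diag_mx !mxE.
    by case: eqP => [->|]; rewrite ?mulr0.
  by rewrite ltcR (pencil_eigen_gt0 hH (spd_scalar1 _ _) dH).
pose S := \row_i sqrtC (D 0 i).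
exists (diag_mx S *m V).
  rewrite unitmx_mul uV andbT unitmxE det_diag unitfE prodf_seq_neq0.
  by apply/allP => i _; rewrite mxE sqrtC_eq0 gt_eqF.
have SD : map_mx Num.conj (diag_mx S)^T *m diag_mx S = diag_mx D.
  rewrite tr_diag_mx map_diag_mx mulmx_diag.
  suff -> : \row_i (map_mx Num.conj S 0 i * S 0 i) = D by [].
  by apply/rowP => i; rewrite !mxE -normCKC ger0_norm ?sqrtC_ge0 ?ltW // sqrtCK.
by rewrite trmx_mul map_mxM -mulmxA (mulmxA _ (diag_mx S)) SD mulmxA.
Qed.

(** With [H] factored through [W], the congruence of [A] by [invmx W] is Hermitian; its unitary
    diagonalizer [V] yields [Q = V *m W]. The columns of [invmx Q] are pencil eigenvectors, which
    makes the diagonal real. *)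
Lemma pencil_diag n (A H : 'M[R]_n) : A^T = A -> spd H ->
  exists (Q : 'M[R[i]]_n) (d : 'I_n -> R),
    [/\ Q \in unitmx, toC H = Q^h *m Q,
        toC A = Q^h *m diag_mx (\row_i (d i)%:C%C) *m Q &
        forall i, pencil_eigen A H (d i)].
Proof.
move=> aT hH; have [W uW eH] := spd_factor hH.
have uWh : W^h \in unitmx by rewrite map_unitmx unitmx_tr.
have hh m p (M : 'M[R[i]]_(m, p)) : (M^h)^h = M.
  by apply/matrixP => i j; rewrite !mxE conjCK.
have hM m p q (M : 'M[R[i]]_(m, p)) (N : 'M[R[i]]_(p, q)) : (M *m N)^h = N^h *m M^h.
  by rewrite trmx_mul map_mxM.
have hW : (invmx W)^h = invmx W^h by rewrite trmx_inv map_invmx.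
have /hermitian_diag[V [D [uV iV e]]] :
    (invmx W^h *m toC A *m invmx W)^h = invmx W^h *m toC A *m invmx W.
  by rewrite !hM hW -hW hh map_complexH aT mulmxA hW.
have eA : toC A = (V *m W)^h *m diag_mx D *m (V *m W).
  rewrite hM -!mulmxA (mulmxA (diag_mx D)) (mulmxA V^h) [V^h *m _]mulmxA -e.
  by rewrite !mulmxA mulmxV // mul1mx mulmxKV.
have eHQ : toC H = (V *m W)^h *m (V *m W).
  by rewrite hM -mulmxA (mulmxA V^h) -iV mulVmx // mul1mx.
have uQ : V *m W \in unitmx by rewrite unitmx_mul uV.
have dP i : exists2 d, D 0 i = (d%:C)%C & pencil_eigen A H d.
  apply: (pencil_real (v := invmx (V *m W) *m delta_mx i 0) aT hH).
    apply/eqP => /(congr1 (mulmx (V *m W))); rewrite mulKVmx // mulmx0.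
    by move=> /matrixP/(_ i 0); rewrite !mxE !eqxx => /eqP; rewrite oner_eq0.
  rewrite eA eHQ -!mulmxA !(mulmxA V) mulKVmx // scalemxAr.
  congr (_ *m _); apply/matrixP => j k; rewrite mul_diag_mx !mxE.
  by case: eqP => [->|]; rewrite ?mulr0.
have dE i : D 0 i = ((complex.Re (D 0 i))%:C)%C by have [d -> _] := dP i.
have rowE : \row_i ((complex.Re (D 0 i))%:C)%C = D by apply/rowP => i; rewrite mxE -dE.
exists (V *m W), (fun i => complex.Re (D 0 i)); rewrite rowE; split=> // i.
by have [d -> //] := dP i.
Qed.

(** In the coordinates [y = Q w] the three forms are sums of [|y_i|^2] weighted by [1], [d_i],
    [d_i ^+ 2]. Hence a quadratic nonnegative on the spectrum yields an inequality between forms,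
    the source of all Rayleigh bounds below. *)
Lemma pencil_form_ge0 n (A H : 'M[R]_n) (al be ga : R) :
    A^T = A -> spd H ->
    (forall d, pencil_eigen A H d -> 0 <= al + be * d + ga * d ^+ 2) ->
  forall w, 0 <= al * dotc w (H *m w) + be * dotc w (A *m w)
               + ga * dotc (A *m w) (invmx H *m (A *m w)).
Proof.
move=> aT hH pos w; have [Q [d [uQ eH eA dP]]] := pencil_diag aT hH.
have uH := spd_unit hH.
have uQh : Q^h \in unitmx by rewrite map_unitmx unitmx_tr.
pose y := Q *m toC w.
have dotE (M : 'M[R]_n) (e : 'I_n -> R) :
    toC M = Q^h *m diag_mx (\row_i (e i)%:C%C) *m Q ->
    ((dotc w (M *m w))%:C)%C = \sum_i (e i)%:C%C * `|y i 0| ^+ 2.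
  move=> eM; transitivity ((toC (w^T *m (M *m w))) 0 0); first by rewrite mxE.
  rewrite !map_mxM eM -map_complexH !mulmxA -map_mxM -trmx_mul -!mulmxA.
  rewrite mul_diag_mx mxE; apply: eq_bigr => i _.
  by rewrite !mxE mulrCA normCKC.
have eInv : toC (A *m invmx H *m A) = Q^h *m diag_mx (\row_i (d i ^+ 2)%:C%C) *m Q.
  have QQ : Q *m invmx (Q^h *m Q) *m Q^h = 1%:M.
    apply: (can_inj (mulKmx uQh)); rewrite !mulmxA mulmxV ?unitmx_mul ?uQh //.
    by rewrite mul1mx mulmx1.
  rewrite !map_mxM map_invmx eH eA.
  rewrite -!mulmxA (mulmxA Q) [X in _ *m (_ *m X)]mulmxA QQ mul1mx.
  rewrite (mulmxA (diag_mx _) (diag_mx _)) mulmx_diag; congr (_ *m (diag_mx _ *m _)).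
  by apply/rowP => i; rewrite !mxE rmorphXn expr2.
have eH1 : toC H = Q^h *m diag_mx (\row_i (1 : R)%:C%C) *m Q.
  rewrite eH; congr (_ *m _); rewrite -[LHS]mulmx1; congr (_ *m _).
  by apply/matrixP => i j; rewrite !mxE.
rewrite dotc_mull aT (mulmxA (invmx H)) (mulmxA A) (mulmxA A) -ler0c.
rewrite !rmorphD !rmorphM /= (dotE _ _ eH1) (dotE _ _ eA) (dotE _ _ eInv).
rewrite !mulr_sumr -!big_split /=; apply: sumr_ge0 => i _.
have := exprn_ge0 2 (normr_ge0 (y i 0)); move: (`|_| ^+ 2) => Y Y0.
rewrite !mulrA -!mulrDl -!rmorphM -!rmorphD mulr_ge0 // mulr1.
by have := pos _ (dP i); rewrite -ler0c.
Qed.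

End Pencil.

(** * The preconditioned saddle-point pencil *)

Section Main.
Variable R : realType.

(** * Rayleigh quotients of definite pencils *)

Lemma pencil_eigen_itv n (A H : 'M[R]_n) a b :
    A^T = A -> spd H ->
    smallest_eigenvalue (invmx H *m A) a -> largest_eigenvalue (invmx H *m A) b ->
  pencil_eigen A H a /\ forall d, pencil_eigen A H d -> a <= d <= b.
Proof.
move=> aT hH [ea ha] [_ hb]; have uH := spd_unit hH.
split=> [|d /(eigenvalue_pencilP d hH.1 aT uH) ed]; last by rewrite ha ?hb.
exact/(eigenvalue_pencilP a hH.1 aT uH).
Qed.

Lemma pencil_rayleigh n (A H : 'M[R]_n) (lo hi : R) (w : 'cV_n) :
    A^T = A -> spd H -> (forall d, pencil_eigen A H d -> lo <= d <= hi) ->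
    w != 0 ->
  exists2 r, lo <= r <= hi & dotc w (A *m w) = r * dotc w (H *m w).
Proof.
move=> aT hH hd w0; have t0 : 0 < dotc w (H *m w) by have /spdP[_ ->] := hH.
exists (dotc w (A *m w) / dotc w (H *m w)); last by rewrite mulfVK ?gt_eqF.
rewrite ler_pdivlMr // ler_pdivrMr //; apply/andP; split.
  have := @pencil_form_ge0 _ _ _ _ (- lo) 1 0 aT hH _ w.
  rewrite mul0r addr0 mul1r mulNr addrC subr_ge0; apply=> d /hd; lra.
have := @pencil_form_ge0 _ _ _ _ hi (-1) 0 aT hH _ w.
by rewrite mul0r addr0 mulN1r subr_ge0; apply=> d /hd; lra.
Qed.

(** The eigenvalues [d - l] of the shifted pencil share one sign, so
    [dotc b (invmx H *m b) / dotc w b] is a weighted mean of them and equals [a - l] for some [a] in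
    the interval. *)
Lemma shifted_rayleigh n (A H : 'M[R]_n) (lo hi l : R) (w : 'cV_n)
    (b := A *m w - l *: (H *m w)) :
    A^T = A -> spd H -> (forall d, pencil_eigen A H d -> lo <= d <= hi) ->
    (l < lo) || (hi < l) -> lo <= hi -> b != 0 ->
  exists2 a, lo <= a <= hi & dotc w b = dotc b (invmx H *m b) / (a - l).
Proof.
move=> aT hH hd hl lohi b0.
have gT : (A - l *: H)^T = A - l *: H by rewrite linearB linearZ /= aT hH.1.
have bE : (A - l *: H) *m w = b by rewrite mulmxBl -scalemxAl.
have gd d : pencil_eigen (A - l *: H) H d -> lo <= d + l <= hi.
  move=> [u u0 e]; apply: hd; exists u => //.
  by rewrite scalerDl -e mulmxBl -scalemxAl subrK.
have s0 : 0 < dotc b (invmx H *m b) by have /spdP[_ ->] := spd_inv hH.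
have form be ga : (forall d, lo <= d + l <= hi -> 0 <= be * d + ga * d ^+ 2) ->
    0 <= be * dotc w b + ga * dotc b (invmx H *m b).
  move=> h; have := @pencil_form_ge0 _ _ _ _ 0 be ga gT hH _ w.
  rewrite bE mul0r add0r; apply=> d /gd; rewrite add0r; exact: h.
move: (dotc w b) (dotc b _) s0 form => q s s0 form.
suff [q0 h] : q != 0 /\ lo - l <= s / q <= hi - l.
  exists (l + s / q); first by lra.
  have -> : l + s / q - l = s / q by rewrite addrAC subrr add0r.
  by rewrite invf_div mulrC divfK // gt_eqF.
case/orP: hl => hl.
  (* With [d] a shifted eigenvalue, the two quadratics are [d * (hi - l - d)] and
     [d * (d - (lo - l))]; in the other case [d] is negative and [lo], [hi] swap roles. *)
  have h1 : 0 <= (hi - l) * q + (-1) * s by apply: form => d hdl; nra.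
  have h2 : 0 <= (- (lo - l)) * q + 1 * s by apply: form => d hdl; nra.
  have q0 : 0 < q by rewrite -(pmulr_rgt0 (x := hi - l)); lra.
  by rewrite gt_eqF // ler_pdivlMr // ler_pdivrMr //; split=> //; lra.
have h1 : 0 <= (lo - l) * q + (-1) * s by apply: form => d hdl; nra.
have h2 : 0 <= (- (hi - l)) * q + 1 * s by apply: form => d hdl; nra.
have q0 : q < 0 by rewrite -(nmulr_rgt0 (x := lo - l)); lra.
by rewrite lt_eqF // ler_ndivlMr // ler_ndivrMr //; split=> //; lra.
Qed.

(** An eigenvalue [1 / k] of [X] relative to [H] gives [1 + 1 / k] for [H + X], whose inverse is
    [k / (1 + k)]; the ratio of the two forms is a weighted mean of such values. *)
Lemma resolvent_rayleigh m (X H : 'M[R]_m) (lo hi : R) (e : 'cV_m)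
    (b := (H + X) *m e) :
    spd X -> spd H -> 0 < lo -> lo <= hi ->
    (forall d, pencil_eigen X H d -> lo <= d^-1 <= hi) -> b != 0 ->
  exists2 k, lo <= k <= hi & dotc e b = dotc b (invmx H *m b) * (k / (1 + k)).
Proof.
move=> hX hH lo0 lohi hd b0; have hG := spd_add hH hX.
have hXi d : pencil_eigen X H d -> [/\ 0 < d, lo * d <= 1 & 1 <= hi * d].
  move=> hXd; have d0 := pencil_eigen_gt0 hX hH hXd.
  by have := hd _ hXd; rewrite -[d^-1]mul1r ler_pdivlMr // ler_pdivrMr // => /andP[].
have gd d : pencil_eigen (H + X) H d ->
    [/\ 0 < d - 1, lo * (d - 1) <= 1 & 1 <= hi * (d - 1)].
  move=> [u u0 eu]; apply: hXi; exists u => //.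
  by rewrite scalerBl -eu mulmxDl scale1r addrC addKr.
have s0 : 0 < dotc b (invmx H *m b) by have /spdP[_ ->] := spd_inv hH.
have c0 : 0 < dotc e b.
  have /spdP[_ ->] // := hG.
  by apply: contra b0 => /eqP e0; rewrite /b e0 mulmx0.
have form be ga : (forall d, 0 < d - 1 -> lo * (d - 1) <= 1 -> 1 <= hi * (d - 1) ->
      0 <= be * d + ga * d ^+ 2) ->
    0 <= be * dotc e b + ga * dotc b (invmx H *m b).
  move=> h; have := @pencil_form_ge0 _ _ _ _ 0 be ga hG.1 hH _ e.
  rewrite mul0r add0r; apply=> d /gd[? ? ?]; rewrite add0r; exact: h.
move: (dotc e b) (dotc b _) s0 c0 form => c s s0 c0 form.
(* The quadratics are [d * (1 - lo * (d - 1))] and [d * (hi * (d - 1) - 1)]. *)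
have h1 : 0 <= (1 + lo) * c + (- lo) * s by apply: form => d *; nra.
have h2 : 0 <= (- (1 + hi)) * c + hi * s by apply: form => d *; nra.
have cs : 0 < s - c.
  have hic : hi * (s - c) >= c by lra.
  by rewrite -(pmulr_rgt0 (x := hi)); lra.
exists (c / (s - c)); last by field; rewrite !gt_eqF //; lra.
by rewrite ler_pdivlMr // ler_pdivrMr //; apply/andP; split; lra.
Qed.

(** * Block form of the preconditioner and of the eigenvalue equation *)

Section Blocks.
Variables (n m p : nat).
Implicit Types (A Ah : 'M[R]_n) (Sh : 'M[R]_m) (Xh : 'M[R]_p)
  (B : 'M[R]_(m, n)) (C : 'M[R]_(p, m)).

Lemma trmx_precL Ah Sh Xh B C : spd Ah -> spd Sh -> spd Xh ->
  (precL Ah Sh Xh B C)^T =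
    block_mx (block_mx Ah B^T 0 (- Sh)) (col_mx 0 C^T) 0 Xh.
Proof.
move=> [aT _] [sT _] [xT _].
by rewrite /precL !tr_block_mx !tr_row_mx linearN /= aT sT xT !trmx0.
Qed.

Lemma spd_precD Ah Sh Xh : spd Ah -> spd Sh -> spd Xh -> spd (precD Ah Sh Xh).
Proof. by move=> hA hS hX; apply: spd_block => //; apply: spd_block. Qed.

(** This is a congruence of the inverse of [precD]; injectivity of the transposed [precL] is back
    substitution through [z], [y], [x]. *)
Lemma spd_prec Ah Sh Xh B C :
  spd Ah -> spd Sh -> spd Xh -> spd (prec Ah Sh Xh B C).
Proof.
move=> hA hS hX; rewrite /prec -[X in X *m invmx _]trmxK.
apply: spd_congr => [|u]; first exact/spd_inv/spd_precD.
rewrite trmx_precL // -[u]vsubmxK -[usubmx u]vsubmxK.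
set x := usubmx (usubmx u); set y := dsubmx (usubmx u); set z := dsubmx u.
rewrite !mul_block_col mul_col_mx !mul0mx !add0r => /eqP.
rewrite col_mx_eq0 => /andP[/eqP e /eqP/(spd_inj hX) z0].
move: e; rewrite z0 !mulmx0 col_mx0 addr0 => /eqP; rewrite col_mx_eq0 mulNmx oppr_eq0.
move=> /andP[/eqP e /eqP/(spd_inj hS) y0].
by move: e; rewrite y0 mulmx0 addr0 => /(spd_inj hA) ->; rewrite !col_mx0.
Qed.

Lemma precE Ah Sh Xh B C : spd Ah -> spd Sh -> spd Xh ->
  prec Ah Sh Xh B C =
    block_mx (block_mx Ah B^T B (schurS Ah B + Sh)) (col_mx 0 (- C^T))
      (row_mx 0 (- C)) (schurS Sh C + Xh).
Proof.
move=> hA hS hX; have [[uA uS] uX] := (spd_unit hA, spd_unit hS, spd_unit hX).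
rewrite /prec trmx_precL // /precL /precD.
have uD : block_mx Ah 0 0 Sh \in unitmx by exact/spd_unit/spd_block.
rewrite invmx_block_diag; last exact/spd_unit/spd_precD.
rewrite invmx_block_diag // !mulmx_block.
rewrite !(mul_row_block, mulmx_block, mul_block_col, mul_row_col,
          mulmx0, mul0mx, addr0, add0r).
rewrite !mulNmx !mulmxN opprK (mulmxV uA) (mulmxV uS) (mulmxV uX) !mul1mx.
by rewrite mulmxKV // mulmxKV.
Qed.

Lemma trmx_saddle A B C : A^T = A -> (saddle_mx A B C)^T = saddle_mx A B C.
Proof.
move=> aT; rewrite /saddle_mx !tr_block_mx tr_col_mx tr_row_mx.
by rewrite aT !trmx0 !trmxK.
Qed.

Lemma saddle_pencil_blocks A Ah Sh Xh B C l : spd Ah -> spd Sh -> spd Xh ->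
  pencil_eigen (saddle_mx A B C) (prec Ah Sh Xh B C) l ->
  exists (x : 'cV_n) (y : 'cV_m) (z : 'cV_p), [/\ [|| x != 0, y != 0 | z != 0],
    A *m x + B^T *m y = l *: (Ah *m x + B^T *m y),
    B *m x + C^T *m z = l *: (B *m x + (schurS Ah B + Sh) *m y - C^T *m z) &
    C *m y = l *: ((schurS Sh C + Xh) *m z - C *m y)].
Proof.
move=> hA hS hX [u u0]; rewrite precE //.
rewrite -[u]vsubmxK -[usubmx u]vsubmxK in u0 *.
move: (usubmx (usubmx u)) (dsubmx (usubmx u)) (dsubmx u) u0 => x y z u0.
rewrite /saddle_mx !mul_block_col !mul_col_mx !mul_row_col !mul0mx !addr0 !add0r.
rewrite !add_col_mx !addr0 scale_col_mx => /eq_col_mx[e1 e3].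
move: e1; rewrite scale_col_mx => /eq_col_mx[e1 e2].
exists x, y, z; split.
- by move: u0; rewrite !col_mx_eq0 !negb_and orbA.
- exact: e1.
- by rewrite e2 mulNmx.
- by rewrite [LHS]e3 mulNmx [in LHS]addrC.
Qed.

End Blocks.

(** Rows one and three express [x] and [z] through [y]; row two paired with [y] is then
    [cubic_quot l a r k] times [dotc y (Sh *m y)]. *)
Lemma saddle_pencil_root n m (A Ah : 'M[R]_n) (B : 'M[R]_(m, n))
    (C Sh Xh : 'M[R]_m) amin amax rmin rmax kmin kmax l :
    spd A -> (forall u : 'cV_m, B^T *m u = 0 -> u = 0) -> C \in unitmx ->
    spd Ah -> spd Sh -> spd Xh ->
    (forall d, pencil_eigen A Ah d -> amin <= d <= amax) ->
    (forall d, pencil_eigen (schurS Ah B) Sh d -> rmin <= d <= rmax) ->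
    (forall d, pencil_eigen Xh (schurS Sh C) d -> kmin <= d^-1 <= kmax) ->
    1 \in `[amin, amax] -> 0 < kmin -> kmin <= kmax ->
    pencil_eigen (saddle_mx A B C) (prec Ah Sh Xh B C) l ->
    l \notin `[amin, amax] ->
  l != 0 /\ exists a r k, [/\ a \in `[amin, amax], r \in `[rmin, rmax],
    k \in `[kmin, kmax] & root (cubic_poly a r k) l].
Proof.
move=> hA injBT uC hAh hSh hXh rgA rgR rgK I1 kmin0 kmin_le.
move=> /(saddle_pencil_blocks hAh hSh hXh)[x [y [z [xyz0 e1 e2 e3]]]] lnI.
have uCT : C^T \in unitmx by rewrite unitmx_tr.
have injCT (u : 'cV_m) : C^T *m u = 0 -> u = 0.
  by move=> h; rewrite -[u](mulKmx uCT) h mulmx0.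
have spdXs := spd_schur hSh injCT.
have spdS := spd_schur hAh injBT.
(* [1] lies in the excluded interval, so [x] may be divided by [l - 1]. *)
have l1 : l - 1 != 0 by rewrite subr_eq0; apply: contraNneq lnI => ->.
have amin_le : amin <= amax by move: I1; rewrite in_itv => /andP[]; exact: le_trans.
have hl : (l < amin) || (amax < l).
  by move: lnI; rewrite in_itv /= negb_and -!ltNge.
have l0 : l != 0.
  apply/eqP => l0; move: xyz0; rewrite l0 !scale0r in e1 e2 e3 *.
  have y0 : y = 0 by rewrite -[y](mulKmx uC) e3 mulmx0.
  rewrite y0 mulmx0 addr0 in e1; have x0 := spd_inj hA e1.
  rewrite x0 mulmx0 add0r in e2.
  by rewrite x0 y0 (injCT _ e2) !eqxx.
have e1' : A *m x - l *: (Ah *m x) = (l - 1) *: (B^T *m y).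
  rewrite -[A *m x](addrK (B^T *m y)) e1 scalerDr scalerBl scale1r.
  by rewrite addrC addrA addKr.
have spdG := spd_add spdXs hXh.
(* If [y] vanished, a nonzero [x] would make [l] an eigenvalue of the pencil of [A], inside the
   excluded interval, and [x = 0] would force [z = 0]. *)
have y0 : y != 0.
  apply/eqP => y0; move: xyz0; rewrite y0 !mulmx0 ?scaler0 in e1' e3 *.
  have [x0|x0] := eqVneq x 0.
    move: e3 => /esym/eqP; rewrite scaler_eq0 (negPf l0) subr0.
    by move=> /eqP/(spd_inj spdG)->; rewrite eqxx.
  have /rgA : pencil_eigen A Ah l by exists x => //; apply/eqP; rewrite -subr_eq0 e1'.
  by move=> lI _; case/negP: lnI; rewrite in_itv.
pose w := (l - 1)^-1 *: x.
have bE : A *m w - l *: (Ah *m w) = B^T *m y.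
  by rewrite -!scalemxAr scalerA mulrC -scalerA -scalerBr e1' scalerA mulVf // scale1r.
have b0 : A *m w - l *: (Ah *m w) != 0.
  by rewrite bE; apply: contra y0 => /eqP/injBT->.
have [a aI] := shifted_rayleigh hA.1 hAh rgA hl amin_le b0.
rewrite bE => qE.
have [r rI sE] := pencil_rayleigh spdS.1 hSh rgR y0.
pose e := invmx (schurS Sh C + Xh) *m (C *m y).
have Ge : (schurS Sh C + Xh) *m e = C *m y by rewrite mulKVmx // spd_unit.
have Cy0 : (schurS Sh C + Xh) *m e != 0.
  by rewrite Ge; apply: contra y0 => /eqP h; rewrite -[y](mulKmx uC) h mulmx0.
have [k kI] := resolvent_rayleigh hXh spdXs kmin0 kmin_le rgK Cy0.
rewrite Ge => cE.
have lz : l *: z = (1 + l) *: e.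
  have lGz : l *: ((schurS Sh C + Xh) *m z) = (1 + l) *: (C *m y).
    by apply: esym; rewrite scalerDl scale1r {1}e3 scalerBr subrK.
  apply/eqP; rewrite -subr_eq0; apply/eqP/(spd_inj spdG).
  by rewrite mulmxBr -!scalemxAr Ge lGz subrr.
(* Invertibility of [C] cancels it from the form, so the [k] term is measured by the same
   [dotc y (Sh *m y)] as the [r] terms. *)
have tE : dotc (C *m y) (invmx (schurS Sh C) *m (C *m y)) = dotc y (Sh *m y).
  pose v := invmx C^T *m (Sh *m y).
  have CTv : C^T *m v = Sh *m y by rewrite mulKVmx.
  have Cyv : schurS Sh C *m v = C *m y.
    by rewrite /schurS -!mulmxA CTv mulKmx ?spd_unit.
  have -> : invmx (schurS Sh C) *m (C *m y) = v by rewrite -Cyv mulKmx ?spd_unit.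
  by rewrite dotc_mull CTv.
have t0 : 0 < dotc y (Sh *m y) by have /spdP[_ ->] := hSh.
split=> //; exists a, r, k; rewrite !in_itv; split=> //.
have al : a != l.
  by apply: contraNneq lnI => <-; rewrite in_itv.
have k0 : 0 < k by case/andP: kI => h _; exact: lt_le_trans h.
apply/rootP; rewrite cubic_quotE //; apply/eqP; rewrite mulf_eq0; apply/orP; left.
have sE' : dotc (B^T *m y) (invmx Ah *m (B^T *m y)) = r * dotc y (Sh *m y).
  by rewrite dotc_mull trmxK -sE /schurS !mulmxA.
have yBx : dotc y (B *m x) = (l - 1) * (r * dotc y (Sh *m y) / (a - l)).
  by rewrite -sE' -qE dotcZl mulVKf // dotcC dotc_mull.
have yCz : dotc y (C^T *m z) = l^-1 * ((1 + l) * (dotc y (Sh *m y) * (k / (1 + k)))).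
  by rewrite -tE -cE -dotcZl -lz dotcZl mulKf // dotcC dotc_mull trmxK.
move: (congr1 (dotc y) e2).
rewrite dotcZr !dotcDr dotcNr mulmxDl dotcDr yBx yCz sE.
move: (dotc y _) t0 => t t0 {}e2.
rewrite -(mulIr_eq0 _ (mulIf (lt0r_neq0 t0))); apply/eqP.
rewrite /cubic_quot; move: (k / (1 + k)) e2 => c /eqP; rewrite -subr_eq0 => /eqP e2.
rewrite -[RHS]e2; have al' : a - l != 0 by rewrite subr_eq0.
by field; rewrite l0 al'.
Qed.

End Main.

(** * Inclusion intervals for the preconditioned spectrum *)

Theorem corollary4p1 (R : realType) (n m : nat)
  (A Ah : 'M[R]_n) (B : 'M[R]_(m, n)) (C Sh Xh Shih Xhih : 'M[R]_m)
  (gAmin gAmax gRmin gRmax gKmin gKmax : R) :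
  (0 < m)%N -> (m <= n)%N ->
  spd A -> row_free B -> C \in unitmx ->
  spd Ah -> spd Sh -> spd Xh ->
  spd_sqrt (invmx Sh) Shih -> spd_sqrt (invmx Xh) Xhih ->
  let K := Xhih *m C *m Shih in
  smallest_eigenvalue (invmx Ah *m A) gAmin ->
  largest_eigenvalue (invmx Ah *m A) gAmax ->
  smallest_eigenvalue (invmx Sh *m schurS Ah B) gRmin ->
  largest_eigenvalue (invmx Sh *m schurS Ah B) gRmax ->
  smallest_eigenvalue (K *m K^T) gKmin ->
  largest_eigenvalue (K *m K^T) gKmax ->
  gAmin < 1 -> 1 < gAmax -> gAmax < 2 ->
  1 \in `[gRmin, gRmax] -> 1 \in `[gKmin, gKmax] ->
  forall z : R[i],
    complex_eigenvalue (invmx (prec Ah Sh Xh B C) *m saddle_mx A B C) z ->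
    exists2 lambda : R, z = (lambda%:C)%C &
      lambda \notin `[gAmin, gAmax] ->
      lambda \in `[mu_a gAmin gRmax gKmax, mu_a gAmax gRmin gKmin] \/
      lambda \in `[mu_b gAmin gRmax gKmin,
                   Num.max (mu_c gAmax gRmin gKmax)
                     (Num.max (mu_c gAmax gRmax gKmax) (beta_c gAmax gKmax))].
Proof.
move=> _ _ hA Bfree uC hAh hSh hXh [sS eS] [sX eX] K mA MA mR MR mK MK A1 A2 A3.
move=> _; rewrite in_itv => /andP[/= K1 K2] z.
rewrite /complex_eigenvalue map_mxM map_invmx => /eigenvalue_pencilP.
have spdP' := spd_prec B C hAh hSh hXh.
have saddleT := trmx_saddle B C hA.1.
(* Real symmetric matrices stay symmetric under plain transposition over [R[i]], as the pencil
   criterion requires. *)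
rewrite !map_trmx spdP'.1 saddleT map_unitmx spd_unit //.
move=> /(_ erefl erefl isT) [v v0 ev].
have [l -> el] := pencil_real saddleT spdP' v0 ev.
exists l => // lnI.
have injBT (u : 'cV_m) : B^T *m u = 0 -> u = 0.
  move=> /(congr1 trmx); rewrite trmx_mul trmxK trmx0 -[0](mul0mx _ B).
  by move=> /(row_free_inj Bfree)/(congr1 trmx); rewrite trmxK trmx0.
have injCT (u : 'cV_m) : C^T *m u = 0 -> u = 0.
  have uCT : C^T \in unitmx by rewrite unitmx_tr.
  by move=> h; rewrite -[u](mulKmx uCT) h mulmx0.
have spdXs := spd_schur hSh injCT.
have spdS := spd_schur hAh injBT.
have [eA rgA] := pencil_eigen_itv hA.1 hAh mA MA.
have [eR rgR] := pencil_eigen_itv spdS.1 hSh mR MR.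
have KKE : K *m K^T = Xhih *m schurS Sh C *m Xhih.
  by rewrite /K /schurS -eS !trmx_mul sX.1 sS.1 !mulmxA.
have uXhih := spd_unit sX.
have spdKK : spd (K *m K^T).
  rewrite KKE -{1}sX.1; apply: spd_congr => // u h.
  by rewrite -[u](mulKmx uXhih) h mulmx0.
(* Ordinary eigenvalues of [K *m K^T] are recast as those of its pencil with the identity. *)
have KK1 : invmx 1%:M *m (K *m K^T) = K *m K^T by rewrite invmx1 mul1mx.
rewrite -KK1 in mK MK.
have [eK rgK] := pencil_eigen_itv spdKK.1 (spd_scalar1 _ _) mK MK.
(* Multiplying [u] by the square root of [Xh], which is [invmx Xhih], gives an eigenvector of
   [K *m K^T] with the reciprocal eigenvalue. *)
have rgK' d : pencil_eigen Xh (schurS Sh C) d -> gKmin <= d^-1 <= gKmax.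
  move=> Xd; have d0 := pencil_eigen_gt0 hXh spdXs Xd; case: Xd => u u0 eu.
  apply: rgK; exists (invmx Xhih *m u).
    by apply: contra u0 => /eqP h; rewrite -[u](mulKVmx uXhih) h mulmx0.
  have XX : Xhih *m Xh = invmx Xhih.
    apply: (can_inj (mulKmx uXhih)).
    by rewrite mulmxA eX mulVmx ?spd_unit // mulmxV.
  rewrite mul1mx KKE -!mulmxA mulKVmx //.
  rewrite -XX -mulmxA eu -scalemxAr scalerA mulVf ?gt_eqF // scale1r.
  by rewrite /schurS -!mulmxA.
have amin0 := pencil_eigen_gt0 hA hAh eA.
have rmin0 := pencil_eigen_gt0 spdS hSh eR.
have kmin0 := pencil_eigen_gt0 spdKK (spd_scalar1 _ _) eK.
have [|||l0 [a [r [k [aI rI kI root_l]]]]] :=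
  saddle_pencil_root hA injBT uC hAh hSh hXh rgA rgR rgK' _ _ _ el lnI.
- by rewrite in_itv /= !ltW.
- exact: kmin0.
- exact: le_trans K1 K2.
have [|lI] := cubic_root_bounds amin0 A1 A2 A3 rmin0 kmin0 aI rI kI l0 lnI root_l.
  by left.
right; move: lI; rewrite !in_itv /= => /andP[-> /le_trans]; apply.
by rewrite maxA le_max lexx.
Qed.
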